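(* Let $G$ be a finite group, $k$ a field of characteristic $0$ containing all roots of unity, and $c:G\times G\times G\to k^*$ a $3$-cocycle. Let $f\in G$. For $h,g$ in the centralizer $C_G(f)$, put (with $g^*=g^{-1}$, $h^*=h^{-1}$) $$\Gamma_{h,g}=\frac{c(h,gf,g^* )\,c(h,g,f)\,c(hgf,g^*,h^* )^{-1}}{c(h,g,g^* )\,c(h,g,1)\,c(hg,g^*,h^* )^{-1}}\in k^*.$$ Then $\Gamma$ is a $2$-cocycle on $C_G(f)$.
   Context: A $3$-cocycle on $G$ is a function $c:G\times G\times G\to k^*$ with $$c(g_3,g_2,g_1)\,c(g_4,g_3g_2,g_1)\,c(g_4,g_3,g_2)=c(g_4,g_3,g_2g_1)\,c(g_4g_3,g_2,g_1)$$ for all $g_4,g_3,g_2,g_1\in G$ (no normalization is assumed). A $2$-cocycle on $C_G(f)$ is a function $\Gamma:C_G(f)\times C_G(f)\to k^*$ with $\Gamma_{h,g}\,\Gamma_{k,hg}=\Gamma_{k,h}\,\Gamma_{kh,g}$ for all $k,h,g\in C_G(f)$ (here $k$ denotes a group element). *)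

(* Defs.v *)
From HB Require Import structures.
From mathcomp Require Import all_boot all_algebra all_fingroup.

Set Implicit Arguments.
Unset Strict Implicit.
Unset Printing Implicit Defensive.

Import GRing.Theory.
Local Open Scope ring_scope.

(* Cochains on a group G : {group gT} with values in k^* are represented by
   functions on gT with values in k that are nonzero on G; their values
   outside of G are irrelevant. *)

Definition is_3cocycle (gT : finGroupType) (k : fieldType) (G : {group gT})
    (c : gT -> gT -> gT -> k) : Prop :=
  (forall g3 g2 g1, g3 \in G -> g2 \in G -> g1 \in G -> c g3 g2 g1 != 0) /\
  (forall g4 g3 g2 g1, g4 \in G -> g3 \in G -> g2 \in G -> g1 \in G ->
    c g3 g2 g1 * c g4 (g3 * g2)%g g1 * c g4 g3 g2
    = c g4 g3 (g2 * g1)%g * c (g4 * g3)%g g2 g1).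

Definition is_2cocycle (gT : finGroupType) (k : fieldType) (H : {group gT})
    (Gam : gT -> gT -> k) : Prop :=
  (forall h g, h \in H -> g \in H -> Gam h g != 0) /\
  (forall l h g, l \in H -> h \in H -> g \in H ->
    Gam h g * Gam l (h * g)%g = Gam l h * Gam (l * h)%g g).

Definition has_all_roots_of_unity (k : fieldType) : Prop :=
  forall n : nat, (0 < n)%N ->
    exists s : seq k, 'X^n - 1 = \prod_(z <- s) ('X - z%:P).

Definition transgression (gT : finGroupType) (k : fieldType)
    (c : gT -> gT -> gT -> k) (f h g : gT) : k :=
  (c h (g * f)%g (g^-1)%g * c h g f * (c (h * g * f)%g (g^-1)%g (h^-1)%g)^-1)
  / (c h g (g^-1)%g * c h g 1%g * (c (h * g)%g (g^-1)%g (h^-1)%g)^-1).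

(* Main.v *)
Require Import Defs.
From mathcomp Require Import all_boot all_algebra all_fingroup.
From mathcomp Require Import ring.

(** View [c] as the associator of the category of [G]-graded vector spaces
    (the pointed fusion category with associator [c]), and let [g] act by
    conjugation, [Phi_g x = (g x) g^-1].  Associators give an isomorphism
    [Phi_h (Phi_g x) -> Phi_(hg) x], whose scalar is [conj_assoc c x h g] below;
    [transgression c f] is the ratio of these scalars at [x = f] and [x = 1].

    The two ways of going from [Phi_l (Phi_h (Phi_g x))] to [Phi_(lhg) x] consist
    of associators only.  By the pentagon axiom they can differ only through
    the final bracketings: [l (h g)] against [(l h) g] on the left of [x], and
    [(g^-1 h^-1) l^-1] against [g^-1 (h^-1 l^-1)] on its right.  Hence
    [conj_assoc c x] satisfies the 2-cocycle identity up to the factor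
    [c l h g / c g^-1 h^-1 l^-1] ([conj_assoc_cocycle]), with
    [Phi_g x = g x g^-1] in place of [x] in one term.  When [l], [h], [g]
    centralize [f], that term is unchanged for [x = f] as well as for [x = 1],
    and the factor, which does not involve [x], cancels in the ratio. *)

Section ConjugationAssociator.

Local Open Scope group_scope.

Variables (gT : finGroupType) (G : {group gT}) (k : fieldType).
Variable c : gT -> gT -> gT -> k.
Hypothesis c_cocycle : is_3cocycle G c.

(** The factors are the three steps
    [(h ((g x) g^-1)) h^-1 -> ((h (g x)) g^-1) h^-1
     -> (((h g) x) g^-1) h^-1 -> ((h g) x) (g^-1 h^-1)]. *)
Definition conj_assoc (x h g : gT) : k :=
  (c h (g * x)%g g^-1%g * c h g x / c (h * g * x)%g g^-1%g h^-1%g)%R.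

Lemma transgressionE f h g :
  transgression c f h g = (conj_assoc f h g / conj_assoc 1 h g)%R.
Proof. by rewrite /transgression /conj_assoc !mulg1. Qed.

Lemma conj_assoc_neq0 x h g :
  x \in G -> h \in G -> g \in G -> conj_assoc x h g != 0%R.
Proof.
move=> xG hG gG; have [c_neq0 _] := c_cocycle.
by rewrite !GRing.mulf_neq0 ?GRing.invr_neq0 ?c_neq0 ?groupM ?groupV.
Qed.

(** Four pentagons connect the two paths: two absorb [l] from the left, one
    moves [l] past the right-hand factors [g^-1] and [h^-1], and one
    rebrackets [g^-1], [h^-1], [l^-1]. *)
Lemma conj_assoc_cocycle x l h g :
    x \in G -> l \in G -> h \in G -> g \in G ->
  (c l h g * (conj_assoc x h g * conj_assoc x l (h * g)%g)
   = c g^-1%g h^-1%g l^-1%g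
     * (conj_assoc (g * x * g^-1)%g l h * conj_assoc x (l * h)%g g))%R.
Proof.
move=> xG lG hG gG; have [c_neq0 pentagon] := c_cocycle.
have [gVG hVG lVG] : [/\ g^-1 \in G, h^-1 \in G & l^-1 \in G].
  by rewrite !groupV.
have pent1 := pentagon l h g x lG hG gG xG.
have pent2 := pentagon l h (g * x) g^-1 lG hG (groupM gG xG) gVG.
have pent3 := pentagon l (h * g * x) g^-1 h^-1 lG
  (groupM (groupM hG gG) xG) gVG hVG.
have pent4 := pentagon (l * h * g * x) g^-1 h^-1 l^-1
  (groupM (groupM (groupM lG hG) gG) xG) gVG hVG lVG.
rewrite /conj_assoc !invMg; rewrite !mulgA in pent1 pent2 pent3 pent4 *.
(* Each pentagon is solved for a factor that occurs in no other pentagon. *)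
have solve (a b d : k) : b != 0%R -> (a * b = d)%R -> a = (d / b)%R.
  by move=> b_neq0 <-; rewrite GRing.mulfK.
rewrite -GRing.mulrA in pent1; rewrite -GRing.mulrA in pent2.
rewrite (solve _ _ _ _ pent1); last first.
  by rewrite GRing.mulf_neq0 ?c_neq0 ?groupM.
rewrite (solve _ _ _ _ pent2); last first.
  by rewrite GRing.mulf_neq0 ?c_neq0 ?groupM.
rewrite (solve _ _ _ _ (esym pent3)); last by rewrite c_neq0 ?groupM.
rewrite (solve _ _ _ _ (esym pent4)); last by rewrite c_neq0 ?groupM.
by field; rewrite !c_neq0 ?groupM.
Qed.

End ConjugationAssociator.

Arguments conj_assoc {gT k} c x h g.

Theorem proposition3p3 (gT : finGroupType) (G : {group gT}) (k : fieldType)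
    (k_char0 : [pchar k]%R =i pred0) (k_roots : has_all_roots_of_unity k)
    (c : gT -> gT -> gT -> k) (c_cocycle : is_3cocycle G c)
    (f : gT) (fG : f \in G) :
  is_2cocycle 'C_G[f]%G (transgression c f).
Proof.
have T_neq0 := @conj_assoc_neq0 _ _ _ _ c_cocycle.
have T_cocycle := @conj_assoc_cocycle _ _ _ _ c_cocycle.
have [c_neq0 _] := c_cocycle.
split=> [h g /setIP[hG _] /setIP[gG _]|l h g].
  by rewrite transgressionE GRing.mulf_neq0 ?GRing.invr_neq0 ?T_neq0.
move=> /setIP[lG _] /setIP[hG _] /setIP[gG /cent1P gf].
have cocycle_f := T_cocycle f l h g fG lG hG gG.
have cocycle_1 := T_cocycle 1%g l h g (group1 G) lG hG gG.
rewrite gf mulgK in cocycle_f; rewrite mulg1 mulgV in cocycle_1.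
have clhg_neq0 : c l h g != 0%R by rewrite c_neq0.
have cV_neq0 : c g^-1%g h^-1%g l^-1%g != 0%R by rewrite c_neq0 ?groupV.
rewrite !transgressionE [LHS]GRing.mulf_div [RHS]GRing.mulf_div.
(* Multiplying numerator and denominator by [c l h g] brings both to the
   left-hand side of [conj_assoc_cocycle]. *)
rewrite -[LHS]GRing.mul1r -(GRing.divff clhg_neq0) [LHS]GRing.mulf_div.
by rewrite cocycle_f cocycle_1 -[LHS]GRing.mulf_div GRing.divff // GRing.mul1r.
Qed.
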